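(* Let $0<\alpha<1$, $h>0$, $f:\mathbb{R}\to\mathbb{R}$, and consider the scheme (F-BDF) $$\sum_{j=0}^n\omega_{n-j}x_j=h^\alpha f(x_n),\qquad n=1,2,3,\dots,\quad x_n\in\mathbb{R},$$ for the scalar equation ${}^{C}_{0}D_t^\alpha x(t)=f(x(t))$, $t>0$. Assume that the real weights $\{\omega_j\}_{j=0}^\infty$ satisfy: $\omega_0>0$; $\omega_j\le0$ for all $j\ge1$; and $\sum_{j=0}^n\omega_j\ge0$ for every $n\ge1$. Let $f$ satisfy the one-sided Lipschitz condition $\langle f(u)-f(v),u-v\rangle\le\lambda\|u-v\|^2$ for all $u,v\in\mathbb{R}$, and let $\{x_n\}$ and $\{y_n\}$ be two solutions of the scheme with different initial values $x_0$ and $y_0$. Then the following contractivity estimate holds: $$\|x_n-y_n\|\le\|x_0-y_0\|\cdot\frac{c_1}{n^\alpha}\quad\text{as } n\to\infty.$$ On the other hand, if $f$ satisfies the dissipativity condition $\langle f(u),u\rangle\le -b\|u\|^2$ for all $u\in\mathbb{R}$, with a constant $b>0$, then the solutions of the scheme decay as $$\|x_n\|\le\|x_0\|\cdot\frac{c_3}{n^\alpha}\quad\text{as } n\to\infty.$$ Here $c_1=(1-\rho_1)^{-1}\frac{c_\alpha}{\omega_0-2\lambda h^\alpha}$ and $c_3=(1-\rho_2)^{-1}\frac{c_\alpha}{\omega_0+2bh^\alpha}$, with $\rho_1$, $\rho_2$ and $c_\alpha$ as defined in the context.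
   Context: On $\mathbb{R}$, $\langle u,v\rangle=uv$ and $\|u\|=|u|$. ${}^{C}_{0}D_t^{\alpha}x(t)=\frac{1}{\Gamma(1-\alpha)}\int_0^t\frac{x'(\tau)}{(t-\tau)^{\alpha}}\,d\tau$ is the Caputo derivative. The number $\lambda$ is the (real) one-sided Lipschitz constant of $f$. A solution of the scheme with initial value $x_0$ is a real sequence $\{x_n\}_{n\ge0}$ starting at $x_0$ and satisfying the scheme for all $n\ge1$. The quantities entering the constants $c_1$ and $c_3$ are $$\rho_1=\sum_{j=1}^\infty\frac{|\omega_j|}{\omega_0-2\lambda h^\alpha},\qquad \rho_2=\sum_{j=1}^\infty\frac{|\omega_j|}{\omega_0+2bh^\alpha},$$ and $c_\alpha>0$ denotes the constant in the decay bounds of the weights: $|\omega_k|\le c_\alpha/k^{1+\alpha}$ for $1\le k\le n-1$ and $|\omega_n|\le c_\alpha/n^\alpha$, for any $n\in\mathbb{N}^+$.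
   Formalization: The contractivity estimate is stated under the added conditions ω_0 − 2λh^α > 0 and ρ_1 < 1 (automatic for λ < 0); otherwise c_1 is undefined or negative and the bound fails, e.g. f(u) = λu with 2λh^α > ω_0 and λh^α ≠ ω_0. *)

(* Defs.v *)
From HB Require Import structures.
From mathcomp Require Import all_boot all_order all_algebra.
From mathcomp Require Import all_classical all_reals all_analysis.
Set Implicit Arguments.
Unset Strict Implicit.
Unset Printing Implicit Defensive.
Import Order.TTheory GRing.Theory Num.Theory.
Import numFieldNormedType.Exports.
Local Open Scope classical_set_scope.
Local Open Scope ring_scope.

Definition fbdf_weights (R : realType) (omega : nat -> R) : Prop :=
  [/\ 0 < omega 0%N,
      forall j, (1 <= j)%N -> omega j <= 0 &
      forall n, (1 <= n)%N -> 0 <= \sum_(0 <= j < n.+1) omega j].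

Definition decay_bounds (R : realType) (omega : nat -> R) (alpha calpha : R)
    : Prop :=
  forall n, (1 <= n)%N ->
    (forall k, (1 <= k <= n.-1)%N ->
       `|omega k| <= calpha / k%:R `^ (1 + alpha)) /\
    `|omega n| <= calpha / n%:R `^ alpha.

(* The initial value of a solution [x] is [x 0]; the scheme does not
   constrain it. *)
Definition fbdf_solution (R : realType) (omega : nat -> R) (alpha h : R)
    (f : R -> R) (x : nat -> R) : Prop :=
  forall n, (1 <= n)%N ->
    \sum_(0 <= j < n.+1) omega (n - j)%N * x j = h `^ alpha * f (x n).

Definition one_sided_lipschitz (R : realType) (f : R -> R) (lambda : R)
    : Prop :=
  forall u v, (f u - f v) * (u - v) <= lambda * `|u - v| ^+ 2.

Definition dissipative (R : realType) (f : R -> R) (b : R) : Prop :=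
  forall u, f u * u <= - b * `|u| ^+ 2.

(* The infinite sums below are limits in R of partial sums; under
   [fbdf_weights] they converge, because the partial sums of
   [`|omega j|], j >= 1, are monotone and bounded by [omega 0]. *)
Definition rho1 (R : realType) (omega : nat -> R) (alpha h lambda : R) : R :=
  \big[+%R/0]_(1 <= j <oo)
     (`|omega j| / (omega 0%N - 2 * lambda * h `^ alpha)).

Definition rho2 (R : realType) (omega : nat -> R) (alpha h b : R) : R :=
  \big[+%R/0]_(1 <= j <oo)
     (`|omega j| / (omega 0%N + 2 * b * h `^ alpha)).

Definition c1 (R : realType) (omega : nat -> R) (alpha h lambda calpha : R)
    : R :=
  (1 - rho1 omega alpha h lambda)^-1 *
  (calpha / (omega 0%N - 2 * lambda * h `^ alpha)).

Definition c3 (R : realType) (omega : nat -> R) (alpha h b calpha : R) : R :=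
  (1 - rho2 omega alpha h b)^-1 *
  (calpha / (omega 0%N + 2 * b * h `^ alpha)).

(* Main.v *)
Require Import Defs.
From mathcomp Require Import all_boot all_order all_algebra.
From mathcomp Require Import all_classical all_reals all_analysis.
From mathcomp Require Import zify ring lra.
Import Order.TTheory GRing.Theory Num.Theory.
Import numFieldNormedType.Exports.
Local Open Scope classical_set_scope.
Local Open Scope ring_scope.

(** Let d be the difference of two solutions, or a single solution in the
    dissipative case. Multiplying the scheme at time n by d n and using the
    sign condition on f gives
      (omega 0 - lambda h^alpha) |d n| <= sum_(j < n) |omega (n - j)| |d j|
    ([energy_estimate]; the dissipative case is lambda = - b). With
    D := omega 0 - lambda h^alpha this is a discrete Volterra inequality for
    |d| with kernel a k := |omega k| / D, and everything follows from two
    facts about this kernel.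

    Its mass is smaller than 1. The constants c1 and c3 are built with
    D2 := omega 0 - 2 lambda h^alpha, and 2 D = D2 + omega 0. The sum of the
    |omega k|, k >= 1, is at most omega 0 because the partial sums of omega are
    nonnegative, and it is smaller than D2 because rho1 < 1; so it is smaller
    than the average D of these two numbers, whatever the sign of lambda. In
    the dissipative case D2 > omega 0, so that rho2 < 1 holds by itself.

    It decays like k^-(1 + alpha): the bound |omega k| <= calpha / k^(1 + alpha)
    holds for all k >= 1, as every k is an interior index for n = k + 1.

    A Volterra inequality whose kernel has mass smaller than 1 passes the decay
    rate of the kernel on to its solutions ([volterra_decay]), so that
    |d n| <= |d 0| K / n^(1 + alpha) for some constant K. This is better by a
    factor 1 / n than the rate claimed; since c1 > 0, the constant K can be
    replaced by c1 once n exceeds K / c1. *)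

(** * Discrete Volterra inequalities *)

Lemma sum_reversed_kernel (V : nmodType) (a : nat -> V) (n : nat) :
  \sum_(0 <= j < n) a (n - j)%N = \sum_(1 <= k < n.+1) a k.
Proof.
rewrite big_nat_rev /= add0n [RHS]big_add1 /=.
by apply: eq_big_nat => i /andP[_ ltin]; rewrite subKn.
Qed.

(** Young's inequality for the convolution of a and u: with U the partial sum of
    u, summing the hypothesis gives U <= u 0 + rho * U. *)
Lemma volterra_sum_le (R : realFieldType) (a u : nat -> R) (rho : R) :
    rho < 1 ->
    (forall k, 0 <= a k) ->
    (forall n, \sum_(1 <= k < n.+1) a k <= rho) ->
    (forall n, 0 <= u n) ->
    (forall n, (1 <= n)%N -> u n <= \sum_(0 <= j < n) a (n - j)%N * u j) ->
  forall n, \sum_(0 <= j < n) u j <= u 0%N / (1 - rho).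
Proof.
move=> rho1 a0 arho u0 urec n.
rewrite ler_pdivlMr ?subr_gt0 // mulrBr mulr1 lerBlDr.
case: n => [|n].
  by rewrite big_geq // mul0r addr0.
rewrite [leLHS]big_nat_recl //= lerD2l.
have -> : \sum_(0 <= i < n) u i.+1 = \sum_(1 <= i < n.+1) u i.
  by rewrite [RHS]big_add1.
(* Summing the inequalities gives a double sum over j < i; exchanging it makes
   each u j carry a partial sum of a. *)
apply: (@le_trans _ _
    (\sum_(1 <= i < n.+1) \sum_(0 <= j < i) a (i - j)%N * u j)).
  by apply: ler_sum_nat => i /andP[i1 _]; exact: urec.
rewrite (eq_big_nat _ _ (F2 := fun i =>
    \sum_(0 <= j < n.+1 | (j < i)%N) a (i - j)%N * u j)); last first.
  by move=> i /andP[_ ltin]; rewrite (big_nat_widen _ _ n.+1) ?(ltnW ltin).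
rewrite (exchange_big_dep_nat xpredT) //= mulr_suml.
apply: ler_sum_nat => j _.
rewrite -mulr_suml mulrC ler_wpM2l //.
have [ltnj|lejn] := ltnP n j.
  rewrite big_nat_cond big_pred0 ?(le_trans _ (arho 0%N)) ?big_geq // => i.
  by apply/negP; lia.
rewrite -(big_nat_widenl j.+1 1 _ xpredT) // -[j.+1]addn1 addnC big_addn.
apply: le_trans (arho (n - j)%N).
by rewrite subSn //; apply: ler_sum_nat => i _; rewrite addnK.
Qed.

(** The index ratio at which [volterra_decay] cuts the convolution: replacing
    n by theta * n in n^-gamma costs a factor theta^-gamma, and the mass rho
    has to stay below 1 after this loss. *)
Lemma exists_contraction_ratio (R : realType) (rho gamma : R) :
    rho < 1 -> 0 < gamma ->
  exists2 theta, 0 < theta < 1 & rho < theta `^ gamma.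
Proof.
move=> rho1 gamma0.
wlog rho0 : rho rho1 / 0 <= rho.
  move=> wl; have [/wl|rho0] := leP 0 rho; first exact.
  have [theta thP th0] := wl 0 ltr01 (lexx 0).
  by exists theta => //; exact: lt_trans th0.
pose m := (1 + rho) / 2; have [m0 m1 rhom] : [/\ 0 < m, m < 1 & rho < m].
  by rewrite /m; split; lra.
exists (m `^ gamma^-1); last first.
  by rewrite -powRrM mulVf ?gt_eqF // powRr1 ?ltW.
rewrite powR_gt0 //=; have : m `^ gamma^-1 < 1 `^ gamma^-1.
  by rewrite gt0_ltr_powR ?invr_gt0 // nnegrE ltW.
by rewrite powR1.
Qed.

(** Strong induction on n, cutting the convolution at j = theta * n. For late j
    the induction hypothesis bounds u j by u 0 * K / (theta * n)^gamma, and the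
    kernel contributes its mass rho. For early j the lag n - j is at least
    (1 - theta) * n, so the kernel is at most C / ((1 - theta) * n)^gamma, and u
    contributes its sum, bounded by u 0 / (1 - rho). The late part reproduces
    K with the factor rho / theta^gamma < 1, so a large K closes the
    induction. *)
Lemma volterra_decay (R : realType) (a u : nat -> R) (rho C gamma : R) :
    rho < 1 -> 0 < gamma ->
    (forall k, 0 <= a k) ->
    (forall n, \sum_(1 <= k < n.+1) a k <= rho) ->
    (forall k, (1 <= k)%N -> a k <= C / k%:R `^ gamma) ->
    (forall n, 0 <= u n) ->
    (forall n, (1 <= n)%N -> u n <= \sum_(0 <= j < n) a (n - j)%N * u j) ->
  exists K, forall n, (1 <= n)%N -> u n <= u 0%N * (K / n%:R `^ gamma).
Proof.
move=> rho1 gamma0 a0 arho aC u0 urec.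
have [theta /andP[th0 th1] rhoth] :=
  exists_contraction_ratio _ rho gamma rho1 gamma0.
have C0 : 0 <= C.
  by have := aC 1%N isT; rewrite powR1 divr1; exact: le_trans.
have rho0 : 0 <= rho by rewrite (le_trans _ (arho 0%N)) ?big_geq.
pose A := theta `^ gamma; pose B := (1 - theta) `^ gamma.
have A0 : 0 < A by rewrite powR_gt0.
have B0 : 0 < B by rewrite powR_gt0 // subr_gt0.
have thetaB0 : 0 < 1 - theta by rewrite subr_gt0.
(* The fixed point of the recursion K = rho / A * K + C / B / (1 - rho) that
   the induction step produces for the constant. *)
pose K := C / B / (1 - rho) / (1 - rho / A).
have rhoA1 : 0 < 1 - rho / A by rewrite subr_gt0 ltr_pdivrMr // mul1r.
have KE : rho / A * K + C / B / (1 - rho) = K.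
  have -> : C / B / (1 - rho) = K * (1 - rho / A).
    by rewrite /K divfK // gt_eqF.
  by ring.
have K0 : 0 <= K.
  by rewrite /K !mulr_ge0 // invr_ge0 ltW // subr_gt0.
exists K; elim/ltn_ind => n IHn n1.
have n0 : 0 < n%:R :> R by rewrite ltr0n.
have ng0 : 0 < n%:R `^ gamma :> R by rewrite powR_gt0.
have KA0 : 0 <= K / (A * n%:R `^ gamma).
  by apply: divr_ge0 => //; rewrite ltW // mulr_gt0.
have CB0 : 0 <= C / (B * n%:R `^ gamma).
  by apply: divr_ge0 => //; rewrite ltW // mulr_gt0.
have bound_term j : (0 <= j < n)%N ->
    a (n - j)%N * u j <=
      a (n - j)%N * (u 0%N * (K / (A * n%:R `^ gamma)))
      + C / (B * n%:R `^ gamma) * u j.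
  move=> /andP[_ ltjn].
  have [lej|ltj] := leP (theta * n%:R) (j%:R : R).
    (* A late index j: the induction hypothesis bounds u j. *)
    apply: ler_wpDr; first exact: mulr_ge0.
    have j0 : 0 < j%:R :> R by rewrite (lt_le_trans _ lej) ?mulr_gt0.
    rewrite ler_wpM2l // (le_trans (IHn j ltjn _)) -?(ltr0n R) //.
    rewrite ler_wpM2l // ler_wpM2l // lef_pV2 ?posrE ?mulr_gt0 ?powR_gt0 //.
    rewrite /A -powRM ?(ltW th0) ?(ltW n0) //.
    by rewrite ge0_ler_powR ?(ltW gamma0) // nnegrE ?mulr_ge0 ?(ltW th0).
  (* An early index j: the lag n - j is of order n, so the kernel is small. *)
  apply: ler_wpDl; first by apply: mulr_ge0 => //; exact: mulr_ge0.
  rewrite ler_wpM2r // (le_trans (aC _ _)) ?subn_gt0 //.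
  rewrite ler_wpM2l // lef_pV2 ?posrE ?mulr_gt0 ?powR_gt0 ?ltr0n ?subn_gt0 //.
  rewrite /B -powRM ?(ltW thetaB0) ?(ltW n0) //.
  rewrite ge0_ler_powR ?(ltW gamma0) // ?nnegrE ?mulr_ge0 ?(ltW thetaB0) //.
  by rewrite natrB ?(ltnW ltjn) //; lra.
apply: (le_trans (urec n n1)).
apply: (le_trans (ler_sum_nat bound_term)).
rewrite big_split /= -mulr_suml -mulr_sumr sum_reversed_kernel.
have S := volterra_sum_le _ a u rho rho1 a0 arho u0 urec n.
apply: (@le_trans _ _ (rho * (u 0%N * (K / (A * n%:R `^ gamma)))
          + C / (B * n%:R `^ gamma) * (u 0%N / (1 - rho)))).
  by apply: lerD; [apply: ler_wpM2r => //; exact: mulr_ge0 | exact: ler_wpM2l].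
rewrite -{2}KE le_eqVlt; apply/orP; left; apply/eqP.
rewrite !invfM; ring.
Qed.

(** * The weights of the scheme *)

Lemma weight_sum_le (R : realType) (omega : nat -> R) :
  fbdf_weights omega ->
  forall n, \sum_(1 <= k < n.+1) `|omega k| <= omega 0%N.
Proof.
move=> [w0 wneg wsum] [|n]; first by rewrite big_geq // ltW.
have := wsum n.+1 isT; rewrite big_ltn //.
rewrite -lerBlDr sub0r -sumrN => /(le_trans _); apply; rewrite le_eqVlt.
apply/orP; left; apply/eqP; apply: eq_big_nat => k /andP[k1 _].
by rewrite ler0_norm // wneg.
Qed.

(** The limit of a divergent sequence has a junk value, so both comparisons of
    the series with its partial sums rest on its convergence, which
    [weight_sum_le] provides. *)
Lemma weight_series_bounds (R : realType) (omega : nat -> R) (D : R) :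
    fbdf_weights omega -> 0 < D ->
  [/\ forall n, (\sum_(1 <= k < n.+1) `|omega k|) / D <=
        \big[+%R/0]_(1 <= j <oo) (`|omega j| / D)
    & \big[+%R/0]_(1 <= j <oo) (`|omega j| / D) <= omega 0%N / D].
Proof.
move=> hw D0; pose p n := \sum_(1 <= k < n) (`|omega k| / D).
have pE n : p n = (\sum_(1 <= k < n) `|omega k|) / D by rewrite mulr_suml.
have w0 : 0 < omega 0%N by case: hw.
have p_le n : p n <= omega 0%N / D.
  rewrite pE ler_pM2r ?invr_gt0 //; case: n => [|n]; last exact: weight_sum_le.
  by rewrite big_geq // ltW.
have p_homo : {homo p : n m / (n <= m)%N >-> n <= m}.
  apply/nondecreasing_seqP => -[|n]; first by rewrite /p !big_geq.
  by rewrite /p [leRHS]big_nat_recr //= lerDl divr_ge0 // ltW.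
have p_cvg : cvgn p.
  apply: nondecreasing_is_cvgn => //; exists (omega 0%N / D) => _ [n _ <-].
  exact: p_le.
split=> [n|]; first by rewrite -pE; exact: nondecreasing_cvgn_le.
by apply: limr_le => //; exact: nearW.
Qed.

(** * Solutions of the scheme *)

(** The linear form of the energy inequality: multiply the scheme by d n, then
    cancel one factor |d n|. Estimating the cross terms by
    2 |d j| |d n| <= |d j|^2 + |d n|^2 instead would lead to the
    denominator omega 0 - 2 * mu and bound only the squares |d n|^2. *)
Lemma energy_estimate (R : realType) (omega d g : nat -> R) (mu : R) (n : nat) :
    \sum_(0 <= j < n.+1) omega (n - j)%N * d j = g n ->
    g n * d n <= mu * `|d n| ^+ 2 ->
  (omega 0%N - mu) * `|d n| <= \sum_(0 <= j < n) `|omega (n - j)%N| * `|d j|.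
Proof.
rewrite big_nat_recr //= subnn => gE gd.
have [->|dn0] := eqVneq (d n) 0.
  by rewrite normr0 mulr0 sumr_ge0 // => j _; rewrite mulr_ge0.
rewrite -(ler_pM2r (_ : 0 < `|d n|)) ?normr_gt0 // -mulrA -expr2.
move: gd; rewrite -gE mulrDl -mulrA -expr2 real_normK ?num_real // => gd.
have -> : (omega 0%N - mu) * d n ^+ 2 = omega 0%N * d n ^+ 2 - mu * d n ^+ 2.
  by rewrite mulrBl.
set s := (\sum_(0 <= j < n) omega (n - j)%N * d j) in gd.
apply: (@le_trans _ _ (- (s * d n))); first by lra.
apply: (le_trans (ler_norm _)); rewrite normrN normrM ler_wpM2r //.
apply: (le_trans (ler_norm_sum _ _ _)).
by apply: ler_sum => j _; rewrite normrM.
Qed.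

(** Common to both estimates: d stands for x - y or x, and g for the right-hand
    side, h^alpha (f x - f y) or h^alpha f x. *)
Lemma fbdf_eventual_decay (R : realType) (alpha h calpha lambda : R)
    (omega d g : nat -> R) :
    0 < alpha -> fbdf_weights omega -> 0 < calpha ->
    decay_bounds omega alpha calpha ->
    0 < omega 0%N - 2 * lambda * h `^ alpha ->
    rho1 omega alpha h lambda < 1 ->
    (forall n, (1 <= n)%N ->
       \sum_(0 <= j < n.+1) omega (n - j)%N * d j = g n) ->
    (forall n, g n * d n <= lambda * h `^ alpha * `|d n| ^+ 2) ->
  \forall n \near \oo,
    `|d n| <= `|d 0%N| * (c1 omega alpha h lambda calpha / n%:R `^ alpha).
Proof.
move=> alpha0 hw calpha0 hdecay D20 rho_lt1 dg gd.
pose D := omega 0%N - lambda * h `^ alpha.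
pose D2 := omega 0%N - 2 * lambda * h `^ alpha.
have w0 : 0 < omega 0%N by case: hw.
have DE : 2 * D = D2 + omega 0%N by rewrite /D /D2; ring.
have D0 : 0 < D by rewrite -/D2 in D20; lra.
have [rho_ge _] := weight_series_bounds _ omega D2 hw D20.
pose r := rho1 omega alpha h lambda.
have rD2 : r * D2 < D2 by rewrite -[ltRHS]mul1r ltr_pM2r.
have c1_gt0 : 0 < c1 omega alpha h lambda calpha.
  by rewrite /c1 !(mulr_gt0, invr_gt0) // subr_gt0.
have [||k|n|k k1|n|n n1|K Kdecay] := volterra_decay R (fun k => `|omega k| / D)
  (fun n => `|d n|) ((r * D2 + omega 0%N) / (2 * D)) (calpha / D) (1 + alpha).
(* The mass bound below is the average of r * D2 and omega 0, divided by D. *)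
- by rewrite ltr_pdivrMr ?mulr_gt0 // mul1r DE ltrD2r.
- by rewrite addr_gt0.
- by rewrite divr_ge0 // ltW.
- rewrite -mulr_suml invfM mulrA ler_pM2r ?invr_gt0 // ler_pdivlMr //.
  rewrite mulr_natr mulr2n lerD ?weight_sum_le //.
  by rewrite -ler_pdivrMr //; exact: rho_ge.
- rewrite mulrAC ler_pM2r ?invr_gt0 //.
  by have [wk _] := hdecay k.+1 isT; apply: wk; rewrite k1 /=.
- exact: normr_ge0.
- have := energy_estimate _ omega d g _ n (dg n n1) (gd n).
  rewrite -/D mulrC -ler_pdivlMr // => /le_trans; apply.
  by rewrite mulr_suml; apply: ler_sum => j _; rewrite mulrAC.
near=> n.
have n1 : (1 <= n)%N by near: n; exact: nbhs_infty_ge.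
have n0 : 0 < n%:R :> R by rewrite ltr0n.
apply: (le_trans (Kdecay n n1)); rewrite ler_wpM2l //.
rewrite powRD ?(lt0r_neq0 n0) ?implybT // powRr1 ?ler0n // invfM mulrA.
rewrite ler_pM2r ?invr_gt0 ?powR_gt0 // ler_pdivrMr // mulrC -ler_pdivrMr //.
by near: n; exact: nbhs_infty_ger.
Unshelve. all: by end_near. Qed.

(* For lambda >= 0 the constant c1 may be undefined (rho1 = 1, or a zero
   denominator) or negative; the two hypotheses on lambda in the first part say
   exactly that c1 is a well-defined positive constant, and they hold for every
   lambda < 0. *)
Theorem theorem3p7 (R : realType) (alpha h calpha : R) (omega : nat -> R)
    (f : R -> R)
    (halpha : 0 < alpha < 1) (hh : 0 < h)
    (homega : fbdf_weights omega)
    (hcalpha : 0 < calpha) (hdecay : decay_bounds omega alpha calpha) :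
  (forall (lambda : R) (x y : nat -> R),
     one_sided_lipschitz f lambda ->
     0 < omega 0%N - 2 * lambda * h `^ alpha ->
     rho1 omega alpha h lambda < 1 ->
     fbdf_solution omega alpha h f x ->
     fbdf_solution omega alpha h f y ->
     x 0%N != y 0%N ->
     \forall n \near \oo,
       `|x n - y n| <=
         `|x 0%N - y 0%N| *
           (c1 omega alpha h lambda calpha / n%:R `^ alpha))
  /\
  (forall (b : R) (x : nat -> R),
     0 < b ->
     dissipative f b ->
     fbdf_solution omega alpha h f x ->
     \forall n \near \oo,
       `|x n| <=
         `|x 0%N| * (c3 omega alpha h b calpha / n%:R `^ alpha)).
Proof.
case/andP: halpha => alpha0 _; have w0 : 0 < omega 0%N by case: homega.
have ha0 : 0 < h `^ alpha by rewrite powR_gt0.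
split=> [lambda x y fL D0 rho_lt1 xsol ysol _|b x b0 fD xsol].
  apply: (fbdf_eventual_decay _ alpha h calpha lambda omega
    (fun n => x n - y n) (fun n => h `^ alpha * (f (x n) - f (y n)))) => //.
    move=> n n1; rewrite mulrBr -xsol // -ysol // -sumrB.
    by apply: eq_bigr => j _; rewrite mulrBr.
  by move=> n; rewrite -mulrA [leRHS]mulrAC [leRHS]mulrC ler_wpM2l // ltW.
(* Dissipativity is the sign condition with constant - b, and c3 is c1 at
   lambda = - b. *)
have DE : omega 0%N - 2 * (- b) * h `^ alpha = omega 0%N + 2 * b * h `^ alpha.
  by rewrite mulrN mulNr opprK.
have D0 : 0 < omega 0%N + 2 * b * h `^ alpha.
  by rewrite addr_gt0 // !mulr_gt0.
have -> : c3 omega alpha h b calpha = c1 omega alpha h (- b) calpha.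
  by rewrite /c3 /c1 /rho2 /rho1 DE.
apply: (fbdf_eventual_decay _ alpha h calpha (- b) omega x
  (fun n => h `^ alpha * f (x n))) => //; first by rewrite DE.
  rewrite /rho1 DE.
  have [_ /le_lt_trans] := weight_series_bounds _ omega _ homega D0.
  by apply; rewrite ltr_pdivrMr // mul1r ltrDl !mulr_gt0.
by move=> n; rewrite -mulrA [leRHS]mulrAC [leRHS]mulrC ler_wpM2l // ltW.
Qed.
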